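(* Let $\theta=(W_L,\ldots,W_1)\in\mathbb{R}^{d_\theta}$ be a weight vector, with flow prebasis subspaces $a_{kji},b_{kji}$ chosen at $\theta$. Then $\Theta^{\mathrm{free}}$ is a prebasis for $\operatorname{null}\mathrm{d}\mu(\theta)$, and so is $\Theta^{\mathrm{fiber}}$. In particular, $\operatorname{null}\mathrm{d}\mu(\theta)=\operatorname{span}\Theta^{\mathrm{free}}=\operatorname{span}\Theta^{\mathrm{fiber}}$. Moreover, the dimension of $\operatorname{null}\mathrm{d}\mu(\theta)$ is $$D^{\mathrm{free}}=d_\theta-\sum_{j=1}^{L}\operatorname{rk}W_{L\sim j}\cdot\operatorname{rk}W_{j-1\sim0}+\sum_{j=1}^{L-1}\operatorname{rk}W_{L\sim j}\cdot\operatorname{rk}W_{j\sim0}.$$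
   Context: Fix integers $L\ge1$, $d_0,\ldots,d_L\ge1$. Weight space: $\mathbb{R}^{d_\theta}=\mathbb{R}^{d_L\times d_{L-1}}\times\cdots\times\mathbb{R}^{d_1\times d_0}$, $d_\theta=\sum_{j=1}^Ld_jd_{j-1}$. For $L\ge k\ge i\ge0$, $W_{k\sim i}=W_kW_{k-1}\cdots W_{i+1}$, $W_{k\sim k}=I_{d_k\times d_k}$; conventions $W_{j\sim-1}=0_{d_j\times1}$, $W_{L+1\sim j}=0_{1\times d_j}$. $\mu(\theta)=W_{L\sim0}$, and its differential map at $\theta$ is $\mathrm{d}\mu(\theta)(\Delta W_L,\ldots,\Delta W_1)=\sum_{j=1}^LW_{L\sim j}\,\Delta W_j\,W_{j-1\sim0}$, a linear map $\mathbb{R}^{d_\theta}\to\mathbb{R}^{d_L\times d_0}$ with nullspace $\operatorname{null}\mathrm{d}\mu(\theta)$. A set of subspaces $\Theta$ is a prebasis for a vector space $V$ if the subspaces are linearly independent (each meets the sum of the others only in $\mathbf 0$) and $\operatorname{span}\Theta:=\sum_{\sigma\in\Theta}\sigma=V$. For subspaces $Y\subseteq Z$, $Z\downarrow Y=\{X\subseteq Z:Z=X\oplus Y\}$. For a matrix $M$ and subspace $Z$, $MZ=\{Mv:v\in Z\}$. Flow subspaces: $A_{kji}=\operatorname{null}W_{k+1\sim j}\cap\operatorname{col}W_{j\sim i}$ and $B_{kji}=\operatorname{row}W_{k\sim j}\cap\operatorname{null}W_{j\sim i-1}^\top$. For $L\ge k\ge j\ge i\ge0$ choose subspaces of $\mathbb{R}^{d_j}$: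 $a_{kji}\in A_{kji}\downarrow(A_{k,j,i-1}+A_{k-1,j,i})$ and $b_{kji}\in B_{kji}\downarrow(B_{k,j,i+1}+B_{k+1,j,i})$, chosen to be flow prebasis subspaces: $a_{kji}=W_ja_{k,j-1,i}$ and $b_{k,j-1,i}=W_j^\top b_{kji}$ whenever $L\ge k\ge j>i\ge0$ (such choices exist). Tensor product: for $U\subseteq\mathbb{R}^p$, $V\subseteq\mathbb{R}^q$, $U\otimes V=\{M\in\mathbb{R}^{p\times q}:\operatorname{col}M\subseteq U,\ \operatorname{row}M\subseteq V\}$. One-matrix subspaces: for $L\ge l\ge j\ge i\ge0$, $L\ge k\ge j-1\ge h\ge0$, $\phi_{lkjih}=\{(0,\ldots,0,M,0,\ldots,0):M\in a_{lji}\otimes b_{k,j-1,h}\}$ with $M$ in the position of $W_j$. $\Theta_{\mathrm O}$ is the set of all $\phi_{lkjih}\ne\{\mathbf 0\}$ with these indices. Two-matrix subspaces: for $L\ge l>j>h\ge0$ and $L\ge k\ge j\ge i\ge0$, $\tau_{lkjih}=\{(0,\ldots,0,W_{j+1}H,-HW_j,0,\ldots,0):H\in a_{lji}\otimes b_{kjh}\}$, with $W_{j+1}H$ in the position of $W_{j+1}$ and $-HW_j$ in the position of $W_j$. $\Theta_{\mathrm T}$ is the set of all $\tau_{lkjih}\ne\{\mathbf 0\}$ with these indices. $\Theta^{\mathrm{free}}=\{\phi_{lkjih}\in\Theta_{\mathrm O}:L>l\text{ or }h>0\}\cup\{\tau_{lkjih}\in\Theta_{\mathrm T}:l=L\text{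 and }h=0\}$. $\Theta^{\mathrm{strat}}=\{\phi_{lkjih}\in\Theta_{\mathrm O}:(L>l\text{ or }h>0)\text{ and }(l\le k\text{ or }i\le h)\}\cup\{\tau_{lkjih}\in\Theta_{\mathrm T}:(l=L\text{ and }h=0)\text{ or }(l>k\text{ and }i>h)\}$. $\Theta^{\mathrm{fiber}}=\Theta^{\mathrm{strat}}\cup\{\phi_{l,k,k+1,i,h}\in\Theta_{\mathrm O}:(L>l\text{ or }h>0)\text{ and }l>k\text{ and }i>h\}$. *)

(* Defs.v *)
From HB Require Import structures.
From mathcomp Require Import all_boot all_order all_algebra.
From mathcomp Require Import boolp classical_sets cardinality fsbigop reals.

Set Implicit Arguments.
Unset Strict Implicit.
Unset Printing Implicit Defensive.

Import GRing.Theory.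
Local Open Scope ring_scope.
Local Open Scope classical_set_scope.

(* Vectors of R^n are column vectors, and M Z = (mulV M @: Z)%VS.  *)
Definition mulV (R : realType) (m n : nat) (M : 'M[R]_(m, n)) :
  'Hom('cV[R]_n, 'cV[R]_m) := linfun (mulmx M).

Definition colsp (R : realType) (m n : nat) (M : 'M[R]_(m, n)) :
  {vspace 'cV[R]_m} := limg (mulV M).

Definition rowsp (R : realType) (m n : nat) (M : 'M[R]_(m, n)) :
  {vspace 'cV[R]_n} := colsp M^T.

Definition nullsp (R : realType) (m n : nat) (M : 'M[R]_(m, n)) :
  {vspace 'cV[R]_n} := lker (mulV M).

(* The matrices with all columns in U and all rows (transposed) in V; see
   mem_tensor for the description in terms of column and row spaces. *)
Definition tensor (R : realType) (p q : nat) (U : {vspace 'cV[R]_p})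
    (V : {vspace 'cV[R]_q}) : {vspace 'M[R]_(p, q)} :=
  ((\bigcap_(c < q) (linfun (@col R p q c) @^-1: U)) :&:
   (\bigcap_(r < p) (linfun (trmx \o @row R p q r) @^-1: V)))%VS.

Lemma colsp_subP (R : realType) (m n : nat) (M : 'M[R]_(m, n))
    (U : {vspace 'cV[R]_m}) :
  reflect (forall c, col c M \in U) (colsp M <= U)%VS.
Proof.
apply: (iffP subvP) => [h c|h v /memv_imgP[x _ ->]]; last rewrite lfunE /=.
  by apply: h; rewrite colE -[M *m _](lfunE (mulmx M)); apply/memv_img/memvf.
have -> : M *m x = \sum_c x c 0 *: col c M.
  apply/colP => r; rewrite !mxE summxE.
  by apply: eq_bigr => c _; rewrite !mxE mulrC.
by apply: rpred_sum => c _; rewrite rpredZ.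
Qed.

Lemma mem_tensor (R : realType) (p q : nat) (U : {vspace 'cV[R]_p})
    (V : {vspace 'cV[R]_q}) (M : 'M[R]_(p, q)) :
  (M \in tensor U V) = (colsp M <= U)%VS && (rowsp M <= V)%VS.
Proof.
have bigcapP (vT : vectType R) k (X : 'I_k -> {vspace vT}) v :
    reflect (forall i, v \in X i) (v \in \bigcap_(i < k) X i)%VS.
  rewrite memvE; apply: (iffP subv_bigcapP) => h i; first by rewrite memvE h.
  by move=> _; rewrite -memvE; apply: h.
rewrite /tensor memv_cap; congr andb; apply/bigcapP/colsp_subP => h i.
- by have := h i; rewrite -memv_preim lfunE.
- by rewrite -memv_preim lfunE; apply: h.
- by have := h i; rewrite -memv_preim lfunE /= tr_row.
- by rewrite -memv_preim lfunE /= tr_row; apply: h.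
Qed.

(* X belongs to Z \downarrow Y; note that Y <= Z is implied. *)
Definition is_compl (R : realType) (vT : vectType R) (Z Y X : {vspace vT}) :
  Prop := [/\ (X <= Z)%VS, (X + Y)%VS = Z & (X :&: Y)%VS = 0%VS].

Definition spanset (R : realType) (vT : vectType R) (T : set {vspace vT}) :
  {vspace vT} := \big[addv/0%VS]_(s \in T) s.

(* Finiteness is required because the sum over an infinite set of nonzero
   subspaces is a junk value. *)
Definition prebasis (R : realType) (vT : vectType R) (T : set {vspace vT})
    (V : {vspace vT}) : Prop :=
  [/\ finite_set T,
      forall s, T s -> (s :&: spanset (T `\ s))%VS = 0%VS
    & spanset T = V].

Definition dtheta (L : nat) (d : nat -> nat) : nat :=
  (\sum_(t < L) d t.+1 * d t)%N.

(* A weight vector is the concatenation of the flattenings of W_1, ..., W_L. *)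
Definition weight_space (R : realType) (L : nat) (d : nat -> nat) :=
  'rV[R]_(dtheta L d).

Section Weights.
Context (R : realType) (L : nat) (d : nat -> nat).
Local Notation weights := (weight_space R L d).

(* The matrix W_j of a weight vector if 1 <= j <= L, and 0 otherwise.  The sum
   has at most one term, whose dimensions agree with those of W_j. *)
Definition layer (w : weights) (j : nat) : 'M[R]_(d j, d j.-1) :=
  \sum_(t < L | t.+1 == j)
    conform_mx 0
      (vec_mx (submxrow (q_ := fun t : 'I_L => (d t.+1 * d t)%N) w t)
        : 'M[R]_(d t.+1, d t)).

(* (0, ..., 0, M, 0, ..., 0) with M in the position of W_j, for 1 <= j <= L. *)
Definition place (j : nat) (M : 'M[R]_(d j, d j.-1)) : weights :=
  \mxrow_(t < L)
    if t.+1 == j then mxvec (conform_mx (0 : 'M[R]_(d t.+1, d t)) M) else 0.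

Fact conform_mx0_linear m n m' n' :
  linear (fun M : 'M[R]_(m, n) => conform_mx (0 : 'M[R]_(m', n')) M).
Proof.
move=> c A B; have [|ne] := boolP ((m == m') && (n == n')).
  by move=> /andP[/eqP em /eqP en]; subst m' n'; rewrite !conform_mx_id.
by rewrite !nonconform_mx ?scaler0 ?addr0 // -negb_and.
Qed.

Fact place_linear j : linear (@place j).
Proof.
move=> c A B; apply/mxrowP => t; rewrite /submxrow linearP /=.
rewrite -!/(submxrow _ _) !mxrowK; case: eqP => _.
  by rewrite conform_mx0_linear linearP.
by rewrite scaler0 addr0.
Qed.
HB.instance Definition _ j :=
  GRing.isLinear.Build R _ _ _ (@place j) (@place_linear j).

Fact layer_linear j : linear (fun w => layer w j).
Proof.
move=> c u v; rewrite /layer scaler_sumr -big_split; apply: eq_bigr => t _ /=.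
by rewrite -conform_mx0_linear /submxrow !linearP.
Qed.

Lemma layer_place j (M : 'M[R]_(d j, d j.-1)) : (0 < j <= L)%N ->
  layer (place M) j = M.
Proof.
case: j M => // j M /andP[_ jL]; rewrite /layer (big_pred1 (Ordinal jL)) //.
by rewrite mxrowK /= eqxx mxvecK !conform_mx_id.
Qed.

Lemma layer_place_neq j j' (M : 'M[R]_(d j, d j.-1)) : j != j' ->
  layer (place M) j' = 0.
Proof.
move=> ne; apply: big1 => t /eqP tj'; rewrite mxrowK tj' eq_sym (negbTE ne).
by rewrite linear0 /conform_mx; do 2?case: eqP => // ?; rewrite castmx_const.
Qed.

(* W_{k~i} = W_k ... W_{i+1} for i <= k; a junk value for k < i.  Note that
   pid_mx (d k) is the identity matrix when it is square of size d k. *)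
Fixpoint Wprod (w : weights) (k i : nat) : 'M[R]_(d k, d i) :=
  match k return 'M[R]_(d k, d i) with
  | 0 => pid_mx (d 0)
  | k'.+1 => if (i <= k')%N then layer w k'.+1 *m Wprod w k' i
             else pid_mx (d k'.+1)
  end.

Lemma Wprod_id w k : Wprod w k k = 1%:M.
Proof. by case: k => [|k]; rewrite /= ?ltnn pid_mx_1. Qed.

Lemma WprodS w k i : (i <= k)%N ->
  Wprod w k.+1 i = layer w k.+1 *m Wprod w k i.
Proof. by move=> ik; rewrite /= ik. Qed.

(* W_{k~j} for k <= L+1, with the convention W_{L+1~j} = 0 (of size 1 x d_j). *)
Definition Wup (w : weights) (k j : nat) :
    'M[R]_(if (k <= L)%N then d k else 1, d j) :=
  if (k <= L)%N as b return 'M[R]_(if b then d k else 1%N, d j)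
  then Wprod w k j else 0.

(* W_{j~i-1} for i >= 0, with the convention W_{j~-1} = 0 (of size d_j x 1). *)
Definition Wdown (w : weights) (j i : nat) :
    'M[R]_(d j, if i is i'.+1 then d i' else 1) :=
  match i return 'M[R]_(d j, if i is i'.+1 then d i' else 1%N) with
  | 0 => 0
  | i'.+1 => Wprod w j i'
  end.

(* flowA w k j i is A_{k-1,j,i-1}, so that the indices -1 can be reached, and
   flowB w k j i is B_{kji}. *)
Definition flowA (w : weights) (k j i : nat) : {vspace 'cV[R]_(d j)} :=
  (nullsp (Wup w k j) :&: colsp (Wdown w j i))%VS.

Definition flowB (w : weights) (k j i : nat) : {vspace 'cV[R]_(d j)} :=
  (rowsp (Wup w k j) :&: nullsp (Wdown w j i)^T)%VS.

(* Only the values at indices i <= j <= k <= L are constrained or used. *)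
Definition subspace_family := forall k j i : nat, {vspace 'cV[R]_(d j)}.

Definition flow_prebasis (w : weights) (a b : subspace_family) : Prop :=
  [/\ forall k j i, (i <= j <= k)%N -> (k <= L)%N ->
        is_compl (flowA w k.+1 j i.+1)
                 (flowA w k.+1 j i + flowA w k j i.+1)%VS (a k j i),
      forall k j i, (i <= j <= k)%N -> (k <= L)%N ->
        is_compl (flowB w k j i)
                 (flowB w k j i.+1 + flowB w k.+1 j i)%VS (b k j i),
      forall k j i, (i < j <= k)%N -> (k <= L)%N ->
        a k j i = (mulV (layer w j) @: a k j.-1 i)%VS
    & forall k j i, (i < j <= k)%N -> (k <= L)%N ->
        b k j.-1 i = (mulV (layer w j)^T @: b k j i)%VS].

(* The differential at w of the map w |-> Wprod w L 0. *)
Definition dmu (w dw : weights) : 'M[R]_(d L, d 0) :=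
  \sum_(1 <= j < L.+1) Wprod w L j *m layer dw j *m Wprod w j.-1 0.

Fact dmu_linear w : linear (dmu w).
Proof.
move=> c u v; rewrite /dmu scaler_sumr -big_split; apply: eq_bigr => j _ /=.
by rewrite layer_linear mulmxDr mulmxDl -scalemxAr -scalemxAl.
Qed.
HB.instance Definition _ w :=
  GRing.isLinear.Build R _ _ _ (dmu w) (dmu_linear w).

Definition null_dmu (w : weights) : {vspace weights} := lker (linfun (dmu w)).

Definition phi (a b : subspace_family) (l k j i h : nat) : {vspace weights} :=
  (linfun (@place j) @: tensor (a l j i) (b k j.-1 h))%VS.

Definition two_matrix (w : weights) (j : nat) (H : 'M[R]_(d j, d j)) :
  weights := @place j.+1 (layer w j.+1 *m H) + place (- (H *m layer w j)).

Fact two_matrix_linear w j : linear (@two_matrix w j).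
Proof.
move=> c A B; rewrite /two_matrix mulmxDr mulmxDl -scalemxAr -scalemxAl opprD.
by rewrite -scalerN !linearP /= scalerDr addrACA.
Qed.
HB.instance Definition _ w j :=
  GRing.isLinear.Build R _ _ _ (@two_matrix w j) (@two_matrix_linear w j).

Definition tau (w : weights) (a b : subspace_family) (l k j i h : nat) :
    {vspace weights} :=
  (linfun (@two_matrix w j) @: tensor (a l j i) (b k j h))%VS.

(* The elements phi_{lkjih} of Theta_O (resp. tau_{lkjih} of Theta_T) whose
   indices satisfy P.  The conditions k >= j-1 >= h are written
   j <= k.+1 and h < j to avoid truncated subtraction. *)
Definition ThetaO (a b : subspace_family)
    (P : nat -> nat -> nat -> nat -> nat -> Prop) : set {vspace weights} :=
  [set s | exists l k j i h,
     [/\ (i <= j <= l)%N /\ (l <= L)%N,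
         (h < j <= k.+1)%N /\ (k <= L)%N,
         P l k j i h, phi a b l k j i h <> 0%VS & s = phi a b l k j i h]].

Definition ThetaT (w : weights) (a b : subspace_family)
    (P : nat -> nat -> nat -> nat -> nat -> Prop) : set {vspace weights} :=
  [set s | exists l k j i h,
     [/\ (h < j < l)%N /\ (l <= L)%N,
         (i <= j <= k)%N /\ (k <= L)%N,
         P l k j i h, tau w a b l k j i h <> 0%VS
       & s = tau w a b l k j i h]].

Definition ThetaFree (w : weights) (a b : subspace_family) :
    set {vspace weights} :=
  ThetaO a b (fun l k j i h => (l < L)%N \/ (0 < h)%N)
  `|` ThetaT w a b (fun l k j i h => l = L /\ h = 0%N).

Definition ThetaStrat (w : weights) (a b : subspace_family) :
    set {vspace weights} :=
  ThetaO a b (fun l k j i h =>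
    ((l < L)%N \/ (0 < h)%N) /\ ((l <= k)%N \/ (i <= h)%N))
  `|` ThetaT w a b (fun l k j i h =>
    (l = L /\ h = 0%N) \/ ((k < l)%N /\ (h < i)%N)).

Definition ThetaFiber (w : weights) (a b : subspace_family) :
    set {vspace weights} :=
  ThetaStrat w a b
  `|` ThetaO a b (fun l k j i h =>
    [/\ j = k.+1, (l < L)%N \/ (0 < h)%N, (k < l)%N & (h < i)%N]).

End Weights.

(* Main.v *)
(* Write X_j = phi_{lkjih} along a chain (l, k, i, h).  At each node the a's
   (resp. b's) decompose R^{d_j}, so the subspaces X_j of all chains decompose
   the weight space.  Multiplication by the layer matrices identifies the X_j
   of a chain with one another, and tau_j is the antidiagonal of
   X_j + X_{j+1}; hence along any chosen set of chains every X_j but the last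
   may be replaced by tau_j, as the span is kept and the dimensions are
   unchanged.  The differential dmu kills every tau_j and every X_j of a chain
   with l < L or h > 0, and it is injective on the sum of the last X_j of the
   special chains l = L, h = 0, whose images lie in the independent subspaces
   a_{LLi} (x) b_{k00}.  So once the special chains are among those exchanged,
   dropping their last X_j leaves a prebasis of the kernel.  Exchanging only
   the special chains gives Theta^free; exchanging also those with l > k and
   i > h gives Theta^fiber. *)

Require Import Defs.
From mathcomp Require Import all_boot all_order all_algebra.
From mathcomp Require Import boolp classical_sets cardinality fsbigop reals.
From mathcomp Require Import zify.

Set Implicit Arguments.
Unset Strict Implicit.
Unset Printing Implicit Defensive.

Import GRing.Theory.
Local Open Scope ring_scope.

(** * Direct sums of indexed families of subspaces *)

Section DirectSums.
Context (K : fieldType) (vT : vectType K) (I : finType).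

Lemma directv_dim_full (P : pred I) (F : I -> {vspace vT}) :
  (\sum_(i | P i) F i = fullv)%VS ->
  (\sum_(i | P i) \dim (F i))%N = dim vT -> directv (\sum_(i | P i) F i).
Proof. by move=> sF dF; rewrite directvE /= sF dF dimvf. Qed.

Lemma directv_sub (P Q : pred I) (F : I -> {vspace vT}) : {subset Q <= P} ->
  directv (\sum_(i | P i) F i) -> directv (\sum_(i | Q i) F i).
Proof.
move=> sQP /directv_sumP dP; apply/directv_sumP => i Qi.
apply/eqP; rewrite -subv0 -[X in (_ <= X)%VS](dP i (sQP _ Qi)).
apply: capvS; first exact: subvv.
apply/subv_sumP => j /andP[Qj ji]; apply: (sumv_sup j); rewrite ?subvv //.
by rewrite [P j](sQP _ Qj).
Qed.

(** Otherwise the nonzero [F i] would also lie in the sum of the other members. A set of subspaces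
    forgets repetitions, so this is what makes it as good as the indexed family. *)
Lemma directv_inj (P : pred I) (F : I -> {vspace vT}) i j :
  directv (\sum_(i | P i) F i) -> P i -> P j -> F i <> 0%VS -> F i = F j -> i = j.
Proof.
move=> /directv_sumP dP Pi Pj Fi eF; apply/eqP/contraT => ij; case: Fi.
apply/eqP; rewrite -subv0 -[X in (_ <= X)%VS](dP i Pi) subv_cap subvv eF.
by apply: (sumv_sup j); rewrite ?subvv // Pj eq_sym.
Qed.

End DirectSums.

(** * Prebases, as sets, obtained from direct indexed families *)

Section SetPrebasis.
Context (R : realType) (vT : vectType R) (I : finType).

Lemma spanset_image (P : pred I) (F : I -> {vspace vT}) :
  {in P &, forall i j, F i <> 0%VS -> F i = F j -> i = j} ->
  spanset [set s | exists i, [/\ P i, F i <> 0%VS & s = F i]]%classic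
    = (\sum_(i | P i) F i)%VS.
Proof.
move=> inj.
pose Q := [pred i | P i && (F i != 0%VS)].
have -> : [set s | exists i, [/\ P i, F i <> 0%VS & s = F i]]%classic
    = (F @` [set` Q])%classic.
  apply/seteqP; split=> s /=.
    by move=> [i [Pi Fi ->]]; exists i => //; apply/andP; split=> //; apply/eqP.
  by move=> [i /andP[Pi /eqP Fi] <-]; exists i.
rewrite /spanset fsbig_image; last first.
  by move=> i j; rewrite !inE /= => /andP[Pi /eqP Fi] /andP[Pj _]; apply: inj.
rewrite -(@bigfs _ _ _ _ (index_enum I) Q) ?index_enum_uniq //; last first.
  by move=> i _; rewrite mem_index_enum.
(* The indices with [F i] zero, absent from the set, return to the sum at no cost. *)
rewrite /Q big_mkcondr; apply: eq_bigr => i _.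
by case: eqP => // ->.
Qed.

Lemma prebasis_directv (P : pred I) (F : I -> {vspace vT}) :
  directv (\sum_(i | P i) F i) ->
  prebasis [set s | exists i, [/\ P i, F i <> 0%VS & s = F i]]%classic
    (\sum_(i | P i) F i)%VS.
Proof.
move=> dF; split.
- apply: (@sub_finite_set _ _ (F @` [set: I])%classic).
    by move=> s [i [_ _ ->]]; exists i.
  exact: finite_image.
- move=> s [i [Pi Fi ->]].
  (* Deleting the subspace [F i] deletes the index [i] only, by [directv_inj]. *)
  have -> : ([set s | exists i, [/\ P i, F i <> 0%VS & s = F i]] `\ F i)%classic
    = [set s | exists j, [/\ P j && (j != i), F j <> 0%VS & s = F j]]%classic.
    apply/seteqP; split=> t /=.
      move=> [[j [Pj Fj ->]] ne]; exists j; split=> //; rewrite Pj.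
      by apply: contra_notN ne => /eqP ->.
    move=> [j [/andP[Pj ji] Fj ->]]; split; first by exists j.
    by move=> eF; move/eqP: ji; apply; apply: directv_inj dF Pj Pi Fj eF.
  rewrite spanset_image; first by apply: (directv_sumP dF).
  move=> j k; rewrite -!topredE /= => /andP[Pj _] /andP[Pk _].
  exact: directv_inj dF Pj Pk.
- by apply: spanset_image => i j Pi Pj; apply: directv_inj dF Pi Pj.
Qed.

End SetPrebasis.

(** * Column spaces, null spaces and tensor products of subspaces *)

Section MatrixSpaces.
Context (R : realType).

Lemma mem_nullsp m n (M : 'M[R]_(m, n)) v :
  (v \in nullsp M) = (M *m v == 0).
Proof. by rewrite memv_ker lfunE. Qed.

Lemma colspP m n (M : 'M[R]_(m, n)) v :
  reflect (exists u, v = M *m u) (v \in colsp M).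
Proof.
apply: (iffP memv_imgP) => [[u _ ->]|[u ->]]; exists u => //.
- by rewrite lfunE.
- exact: memvf.
- by rewrite lfunE.
Qed.

Lemma mulVE m n (M : 'M[R]_(m, n)) v : mulV M v = M *m v.
Proof. exact: lfunE. Qed.

Lemma mulV1 n (U : {vspace 'cV[R]_n}) : (mulV 1%:M @: U)%VS = U.
Proof.
apply/vspaceP => v; apply/memv_imgP/idP => [[u uU ->]|vU].
  by rewrite mulVE mul1mx.
by exists v; rewrite // mulVE mul1mx.
Qed.

Lemma mem_mulV m n (M : 'M[R]_(m, n)) (U : {vspace 'cV[R]_n}) v :
  v \in U -> M *m v \in (mulV M @: U)%VS.
Proof. by move=> vU; rewrite -mulVE memv_img. Qed.

Lemma dim_mulV_inj m n (M : 'M[R]_(m, n)) (U : {vspace 'cV[R]_n}) :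
  {in U, forall v, M *m v = 0 -> v = 0} -> \dim (mulV M @: U) = \dim U.
Proof.
move=> inj; apply: limg_dim_eq; apply/eqP; rewrite -subv0.
apply/subvP => v; rewrite memv_cap memv0 => /andP[vU].
by rewrite mem_nullsp => /eqP /(inj _ vU) ->.
Qed.

Lemma tensorP p q (U : {vspace 'cV[R]_p}) (V : {vspace 'cV[R]_q})
    (M : 'M[R]_(p, q)) :
  reflect ((forall v, M *m v \in U) /\ (forall v, M^T *m v \in V))
          (M \in tensor U V).
Proof.
rewrite mem_tensor; apply: (iffP andP) => [[/subvP MU /subvP MV]|[MU MV]].
  by split=> v; [apply: MU|apply: MV]; apply/colspP; exists v.
by split; apply/subvP => _ /colspP[v ->].
Qed.

Lemma outer_tensor p q (U : {vspace 'cV[R]_p}) (V : {vspace 'cV[R]_q}) u v :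
  u \in U -> v \in V -> u *m v^T \in tensor U V.
Proof.
move=> uU vV; apply/tensorP; rewrite trmx_mul trmxK.
by split=> x; rewrite -mulmxA [_ *m x]mx11_scalar mul_mx_scalar rpredZ.
Qed.

Lemma tensor_mull_inj m p q (U : {vspace 'cV[R]_p}) (V : {vspace 'cV[R]_q})
    (W : 'M[R]_(m, p)) :
  {in U, forall u, W *m u = 0 -> u = 0} ->
  {in tensor U V, forall M, W *m M = 0 -> M = 0}.
Proof.
move=> inj M /tensorP[MU _] WM0; apply/matrixP => r c.
have : M *m delta_mx c 0 = 0 :> 'cV_p.
  by apply: inj; rewrite ?MU // mulmxA WM0 mul0mx.
by rewrite -colE => /colP/(_ r); rewrite !mxE.
Qed.

Lemma tr_tensor p q (U : {vspace 'cV[R]_p}) (V : {vspace 'cV[R]_q}) M :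
  (M^T \in tensor V U) = (M \in tensor U V).
Proof. by rewrite !mem_tensor /rowsp trmxK andbC. Qed.

Lemma tensor_mulr_inj m p q (U : {vspace 'cV[R]_p}) (V : {vspace 'cV[R]_q})
    (W : 'M[R]_(q, m)) :
  {in V, forall v, W^T *m v = 0 -> v = 0} ->
  {in tensor U V, forall M, M *m W = 0 -> M = 0}.
Proof.
move=> inj M; rewrite -tr_tensor => /(tensor_mull_inj inj) M0 MW.
by apply: trmx_inj; rewrite trmx0 M0 // -trmx_mul MW trmx0.
Qed.

Lemma tensor_mull m p q (U : {vspace 'cV[R]_p}) (V : {vspace 'cV[R]_q})
    (W : 'M[R]_(m, p)) M :
  M \in tensor U V -> W *m M \in tensor (mulV W @: U)%VS V.
Proof.
move=> /tensorP[MU MV]; apply/tensorP; split=> v.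
  by rewrite -mulmxA mem_mulV.
by rewrite trmx_mul -mulmxA.
Qed.

Lemma tensor_mulr m p q (U : {vspace 'cV[R]_p}) (V : {vspace 'cV[R]_q})
    (W : 'M[R]_(q, m)) M :
  M \in tensor U V -> M *m W \in tensor U (mulV W^T @: V)%VS.
Proof.
by rewrite -tr_tensor -[X in _ -> is_true X]tr_tensor trmx_mul => /tensor_mull.
Qed.

(** The columns of [B] form a basis of [U], and [C] reads off coordinates in it. They reduce
    [tensor U V] to plain matrices of size [\dim U] by [\dim V]. *)
Lemma subspace_param p (U : {vspace 'cV[R]_p}) :
  exists (B : 'M[R]_(p, \dim U)) (C : 'M[R]_(\dim U, p)),
    [/\ C *m B = 1%:M, forall v, B *m v \in U
      & forall u, u \in U -> B *m (C *m u) = u].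
Proof.
pose b := vbasis U.
pose B : 'M[R]_(p, \dim U) := \matrix_(r, c) b`_c r 0.
pose C : 'M[R]_(\dim U, p) := \matrix_(i, r) coord b i (delta_mx r 0).
have Bv v : B *m v = \sum_i v i 0 *: b`_i.
  by apply/colP => r; rewrite !mxE summxE; apply: eq_bigr => i _; rewrite !mxE mulrC.
have Cu u i : (C *m u) i 0 = coord b i u.
  rewrite mxE [u in RHS]matrix_sum_delta linear_sum; apply: eq_bigr => r _.
  by rewrite big_ord1 linearZ mxE mulrC.
exists B, C; split.
- apply/matrixP => i c; rewrite [LHS](_ : _ = (C *m col c B) i 0); last first.
    by rewrite !mxE; apply: eq_bigr => r _; rewrite !mxE.
  rewrite Cu (_ : col c B = b`_c); last by apply/colP => r; rewrite !mxE.
  by rewrite coord_free ?mxE 1?eq_sym // (basis_free (vbasisP U)).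
- move=> v; rewrite Bv; apply: rpred_sum => i _; apply: rpredZ.
  by apply: vbasis_mem; rewrite mem_nth ?size_tuple.
- move=> u uU; rewrite Bv [RHS](coord_vbasis uU).
  by apply: eq_bigr => i _; rewrite Cu.
Qed.

(** The map [X |-> B *m X *m B'^T] is a bijection from the small matrices onto [tensor U V]; [C] and
    [C'] provide its inverse. *)
Lemma dim_tensor p q (U : {vspace 'cV[R]_p}) (V : {vspace 'cV[R]_q}) :
  \dim (tensor U V) = (\dim U * \dim V)%N.
Proof.
have [B [C [CB BU BC]]] := subspace_param U.
have [B' [C' [CB' BU' BC']]] := subspace_param V.
pose f : 'Hom('M[R]_(\dim U, \dim V), 'M[R]_(p, q)) :=
  linfun (mulmxr B'^T \o mulmx B).
have fE X : f X = B *m X *m B'^T by rewrite lfunE.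
have -> : tensor U V = (f @: fullv)%VS.
  apply/vspaceP => M; apply/idP/memv_imgP.
    move=> /tensorP[MU MV]; exists (C *m M *m C'^T); first exact: memvf.
    have MB : B *m (C *m M) = M.
      by apply/row_matrixP => r; apply/rowP => c;
        have /colP/(_ r) := BC _ (MU (delta_mx c 0));
        rewrite !mulmxA -!colE -mulmxA !mxE.
    have MB' : B' *m (C' *m M^T) = M^T.
      by apply/row_matrixP => r; apply/rowP => c;
        have /colP/(_ r) := BC' _ (MV (delta_mx c 0));
        rewrite !mulmxA -!colE -mulmxA !mxE.
    rewrite fE !mulmxA -(mulmxA B) MB -{1}[M]trmxK -MB'.
    by rewrite !trmx_mul trmxK.
  move=> [X _ ->]; rewrite fE; apply/tensorP; split=> v.
    by rewrite -!mulmxA.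
  by rewrite !trmx_mul trmxK -mulmxA.
rewrite limg_dim_eq ?dimvf ?dim_matrix //.
apply/eqP; rewrite -subv0; apply/subvP => X.
rewrite memv_cap memv_ker memv0 fE => /andP[_ /eqP X0].
rewrite -[X]mul1mx -CB -[X]mulmx1 -trmx1 -CB' trmx_mul !mulmxA.
by rewrite -(mulmxA C) -(mulmxA C) X0 mulmx0 mul0mx.
Qed.

(** No preimage is constructed: right multiplication by [W] is injective on [tensor U V] and lands
    in a space of the same dimension. *)
Lemma tensor_mulr_surj m p q (U : {vspace 'cV[R]_p}) (V : {vspace 'cV[R]_q})
    (W : 'M[R]_(q, m)) (inj : {in V, forall v, W^T *m v = 0 -> v = 0}) M :
  M \in tensor U (mulV W^T @: V)%VS ->
  exists2 H, H \in tensor U V & M = H *m W.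
Proof.
pose f : 'Hom('M[R]_(p, q), 'M[R]_(p, m)) := linfun (mulmxr W).
suff /eqP <- : (f @: tensor U V)%VS == tensor U (mulV W^T @: V)%VS.
  by move=> /memv_imgP[H HT ->]; exists H; rewrite // lfunE.
rewrite eqEdim; apply/andP; split.
  by apply/subvP => _ /memv_imgP[H HT ->]; rewrite lfunE; apply: tensor_mulr.
rewrite limg_dim_eq; first by rewrite !dim_tensor dim_mulV_inj.
apply/eqP; rewrite -subv0; apply/subvP => X.
rewrite memv_cap memv_ker memv0 lfunE /= => /andP[XT /eqP X0].
by rewrite (tensor_mulr_inj inj XT).
Qed.

(** Rank-one matrices suffice. For [w] in some [V j], the [u] with [u *m w^T] in [S] form a subspace
    containing every [U i], hence everything; then the same argument runs in the second factor.
    Generation is phrased through upper bounds [S] so that no sum over a dependent range is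
    needed. *)
Lemma tensor_generate p q (I J : Type) (P : I -> Prop) (Q : J -> Prop)
    (U : I -> {vspace 'cV[R]_p}) (V : J -> {vspace 'cV[R]_q}) :
  (forall S, (forall i, P i -> U i <= S)%VS -> S = fullv) ->
  (forall S, (forall j, Q j -> V j <= S)%VS -> S = fullv) ->
  forall S, (forall i j, P i -> Q j -> tensor (U i) (V j) <= S)%VS -> S = fullv.
Proof.
move=> genU genV S TS.
have outer (u : 'cV[R]_p) (v : 'cV[R]_q) : u *m v^T \in S.
  pose g : 'Hom('cV[R]_q, 'M[R]_(p, q)) := linfun (mulmx u \o trmx).
  suff : v \in (g @^-1: S)%VS by rewrite -memv_preim lfunE.
  rewrite (genV (g @^-1: S)%VS) ?memvf // => j Qj; apply/subvP => w wV.
  rewrite -memv_preim lfunE /=.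
  pose f : 'Hom('cV[R]_p, 'M[R]_(p, q)) := linfun (mulmxr w^T).
  suff : u \in (f @^-1: S)%VS by rewrite -memv_preim lfunE.
  rewrite (genU (f @^-1: S)%VS) ?memvf // => i Pi; apply/subvP => x xU.
  rewrite -memv_preim lfunE /=.
  by apply: (subvP (TS i j Pi Qj)); apply: outer_tensor.
apply/vspaceP => M; rewrite memvf [M]matrix_sum_delta.
apply: rpred_sum => r _; apply: rpred_sum => c _; apply: rpredZ.
by rewrite -(mul_delta_mx (0 : 'I_1)) -[delta_mx 0 c]trmxK trmx_delta outer.
Qed.

(** In the factorization of [M] as [col_base M *m row_base M], the right factor has a right inverse,
    so the image is that of [col_base M], which has a left inverse. *)
Lemma dim_colsp m n (M : 'M[R]_(m, n)) : \dim (colsp M) = \rank M.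
Proof.
have [B' BC] := row_fullP (col_base_full M).
have [C' CC] := row_freeP (row_base_free M).
have ME u : M *m u = col_base M *m (row_base M *m u).
  by rewrite mulmxA mulmx_base.
have -> : colsp M = (mulV (col_base M) @: fullv)%VS.
  apply/vspaceP => v; apply/colspP/idP => [[u ->]|/memv_imgP[u _ ->]].
    by rewrite ME mem_mulV ?memvf.
  exists (C' *m u); rewrite lfunE /=.
  by rewrite ME (mulmxA (row_base M)) CC mul1mx.
rewrite dim_mulV_inj => [|v _ Mv0]; first by rewrite dimvf dim_matrix [LHS]muln1.
by rewrite -[v]mul1mx -BC -mulmxA Mv0 mulmx0.
Qed.

Lemma dim_nullsp m n (M : 'M[R]_(m, n)) : (\dim (nullsp M) + \rank M)%N = n.
Proof.
have := limg_ker_dim (mulV M) fullv.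
by rewrite capfv dimvf dim_matrix -dim_colsp => ->; apply: muln1.
Qed.

End MatrixSpaces.

(** * Counting dimensions by mixed second differences *)

Lemma telescope2 (lo hi m : nat) (f : nat -> nat -> int) (F : nat -> nat -> nat) :
  (lo <= hi)%N ->
  (forall k i, (lo <= k < hi)%N -> (i < m)%N ->
    (F k i)%:Z = f k.+1 i.+1 - f k.+1 i - (f k i.+1 - f k i)) ->
  (\sum_(lo <= k < hi) \sum_(0 <= i < m) F k i)%N%:Z
    = f hi m - f hi 0 - (f lo m - f lo 0).
Proof.
move=> lohi FE; rewrite (big_morph Posz PoszD (erefl (0%N : int))).
rewrite -(@telescope_sumr _ _ _ (fun k => f k m - f k 0) lohi).
apply: eq_big_nat => k kr; rewrite (big_morph Posz PoszD (erefl (0%N : int))).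
rewrite -!(@telescope_sumr _ 0 m) // -sumrB.
by apply: eq_big_nat => i ir; rewrite FE.
Qed.

(** With null spaces for [N], [N'] and column spaces for [C], [C'], this identifies the meet of the
    two flow subspaces whose sum is complemented by [a k j i]: it is again a flow subspace. The b
    side is dual. *)
Lemma cap_nested (K : fieldType) (V : vectType K) (N N' C C' : {vspace V}) :
  (N <= N')%VS -> (C <= C')%VS ->
  ((N' :&: C) :&: (N :&: C'))%VS = (N :&: C)%VS.
Proof.
move=> NN' CC'; rewrite capvA [(_ :&: N)%VS]capvC capvA (capv_idPl NN').
by rewrite -capvA (capv_idPl CC').
Qed.

(** Inclusion-exclusion for [Y1 + Y2] gives the dimension of a complement as a mixed second
    difference, the shape that [telescope2] sums. *)
Lemma dim_compl_cap (R : realType) (V : vectType R)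
    (Z Y1 Y2 Y12 X : {vspace V}) :
  is_compl Z (Y1 + Y2) X -> (Y1 :&: Y2)%VS = Y12 ->
  (\dim X)%:Z = (\dim Z)%:Z - (\dim Y1)%:Z - ((\dim Y2)%:Z - (\dim Y12)%:Z).
Proof.
move=> [_ XY XY0] <-; have := dimv_sum_cap X (Y1 + Y2)%VS.
by rewrite XY XY0 dimv0; have := dimv_sum_cap Y1 Y2; lia.
Qed.

(** * Flow subspaces: generation, dimensions, and their transport between layers *)

Section Flow.
Context (R : realType) (L : nat) (d : nat -> nat) (w : weight_space R L d).
Context (a b : subspace_family R d) (flow_ab : flow_prebasis w a b).

Lemma Wprod_split k m i : (i <= m <= k)%N ->
  Wprod w k i = Wprod w k m *m Wprod w m i.
Proof.
elim: k => [|k IH] /andP[im mk].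
  have -> : m = 0%N by lia.
  have -> : i = 0%N by lia.
  by rewrite !Wprod_id mul1mx.
have [->|mk'] := eqVneq m k.+1; first by rewrite Wprod_id mul1mx.
by rewrite !WprodS ?IH ?mulmxA //; lia.
Qed.

Lemma layerE j : layer w j.+1 = Wprod w j.+1 j.
Proof. by rewrite WprodS // Wprod_id mulmx1. Qed.

Lemma mem_null_Wup k j v : (k <= L)%N ->
  (v \in nullsp (Wup w k j)) = (Wprod w k j *m v == 0).
Proof. by move=> kL; rewrite mem_nullsp /Wup kL. Qed.

Lemma null_Wup_full j : nullsp (Wup w L.+1 j) = fullv.
Proof.
by apply/vspaceP => v; rewrite memvf mem_nullsp /Wup ltnn mul0mx eqxx.
Qed.

Lemma row_WupP k j v : (k <= L)%N ->
  reflect (exists u, v = (Wprod w k j)^T *m u) (v \in rowsp (Wup w k j)).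
Proof. by rewrite /rowsp /Wup => kL; move: (colspP (Wup w k j)^T v); rewrite /Wup kL. Qed.

Lemma Wup_LS j : Wup w L.+1 j = 0.
Proof. by rewrite /Wup; move: (ltnn L); case: (L < L)%N. Qed.

Lemma row_Wup0 j : rowsp (Wup w L.+1 j) = 0%VS.
Proof.
apply/eqP; rewrite -subv0; apply/subvP => v /colspP[u ->].
by rewrite Wup_LS trmx0 mul0mx mem0v.
Qed.

Lemma flowA_i0 k j : flowA w k j 0 = 0%VS.
Proof.
apply/eqP; rewrite -subv0; apply: subv_trans (capvSr _ _) _.
by apply/subvP => v /colspP[u ->]; rewrite mul0mx mem0v.
Qed.

Lemma flowA_kj j i : (j <= L)%N -> flowA w j j i = 0%VS.
Proof.
move=> jL; apply/eqP; rewrite -subv0; apply: subv_trans (capvSl _ _) _.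
by apply/subvP => v; rewrite mem_null_Wup // Wprod_id mul1mx memv0.
Qed.

Lemma flowA_iS k j : flowA w k j j.+1 = nullsp (Wup w k j).
Proof.
apply/capv_idPl/subvP => v _; apply/colspP.
by exists v; rewrite /= Wprod_id mul1mx.
Qed.

Lemma flowB_iS k j : flowB w k j j.+1 = 0%VS.
Proof.
apply/eqP; rewrite -subv0; apply: subv_trans (capvSr _ _) _.
by apply/subvP => v; rewrite mem_nullsp /= Wprod_id trmx1 mul1mx memv0.
Qed.

Lemma flowB_LS j i : flowB w L.+1 j i = 0%VS.
Proof. by rewrite /flowB row_Wup0 cap0v. Qed.

Lemma flowB_kj j i : (j <= L)%N -> flowB w j j i = nullsp (Wdown w j i)^T.
Proof.
move=> jL; apply/capv_idPr/subvP => v _; apply/row_WupP => //.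
by exists v; rewrite Wprod_id trmx1 mul1mx.
Qed.

Lemma null_Wup_sub k j : (j <= k <= L)%N ->
  (nullsp (Wup w k j) <= nullsp (Wup w k.+1 j))%VS.
Proof.
move=> /andP[jk kL]; have [kL'|kL'] : (L <= k)%N \/ (k < L)%N by lia.
  by rewrite (_ : k = L) ?null_Wup_full ?subvf //; lia.
apply/subvP => v; rewrite !mem_null_Wup // => /eqP v0.
by rewrite WprodS // -mulmxA v0 mulmx0.
Qed.

Lemma col_Wdown_sub j i : (i <= j)%N ->
  (colsp (Wdown w j i) <= colsp (Wdown w j i.+1))%VS.
Proof.
case: i => [|i] ij; apply/subvP => v /colspP[u ->]; first by rewrite mul0mx mem0v.
apply/colspP; exists (Wprod w i.+1 i *m u).
by rewrite /= mulmxA -Wprod_split //; lia.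
Qed.

Lemma row_Wup_sub k j : (j <= k <= L)%N ->
  (rowsp (Wup w k.+1 j) <= rowsp (Wup w k j))%VS.
Proof.
move=> /andP[jk kL]; have [kL'|kL'] : (L <= k)%N \/ (k < L)%N by lia.
  by rewrite (_ : k = L) ?row_Wup0 ?sub0v //; lia.
apply/subvP => v /row_WupP [//|u ->]; apply/row_WupP => //.
by exists ((layer w k.+1)^T *m u); rewrite WprodS // trmx_mul mulmxA.
Qed.

Lemma null_Wdown_sub j i : (i <= j)%N ->
  (nullsp (Wdown w j i.+1)^T <= nullsp (Wdown w j i)^T)%VS.
Proof.
case: i => [|i] ij; apply/subvP => v; rewrite !mem_nullsp => /eqP v0.
  by rewrite trmx0 mul0mx.
by rewrite /= (@Wprod_split j i.+1 i) ?trmx_mul -?mulmxA ?v0 ?mulmx0 //; lia.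
Qed.

(** The complement relation is a recursion on [k + i]: each flow subspace is [a k j i] plus two
    earlier ones, starting from zero at [i = 0] or [k = j]. The last one, [flowA w L.+1 j j.+1], is
    the whole space. *)
Lemma a_generate j (S : {vspace 'cV[R]_(d j)}) : (j <= L)%N ->
  (forall k i, (i <= j <= k)%N -> (k <= L)%N -> (a k j i <= S)%VS) -> S = fullv.
Proof.
move=> jL aS; have [cA _ _ _] := flow_ab.
suff AS n k i : (k + i <= n)%N -> (j <= k <= L.+1)%N -> (i <= j.+1)%N ->
    (flowA w k j i <= S)%VS.
  apply/eqP; rewrite eqEsubv subvf /= -(null_Wup_full j) -flowA_iS.
  by apply: AS (leqnn _) _ _; lia.
elim: n k i => [|n IH] k i kin jkL ij.
  by rewrite (_ : i = 0%N) ?flowA_i0 ?sub0v //; lia.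
have [->|kj] := eqVneq k j; first by rewrite flowA_kj ?sub0v.
case: i kin ij => [|i] kin ij; first by rewrite flowA_i0 sub0v.
case: k jkL kin kj => [|k] jkL kin kj; first by lia.
have [_ <- _] : is_compl _ _ _ := cA k j i ltac:(lia) ltac:(lia).
by rewrite !subv_add aS ?IH //; lia.
Qed.

(** Dual to [a_generate], with the order reversed: the recursion starts from zero at [k = L.+1] or
    [i = j.+1] and ends at [flowB w j j 0], the whole space. *)
Lemma b_generate j (S : {vspace 'cV[R]_(d j)}) : (j <= L)%N ->
  (forall k i, (i <= j <= k)%N -> (k <= L)%N -> (b k j i <= S)%VS) -> S = fullv.
Proof.
move=> jL bS; have [_ cB _ _] := flow_ab.
suff BS n k i : (L.+1 - k + (j.+1 - i) <= n)%N -> (j <= k <= L.+1)%N ->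
    (i <= j.+1)%N -> (flowB w k j i <= S)%VS.
  apply/eqP; rewrite eqEsubv subvf /=; apply: subv_trans (BS _ j 0%N (leqnn _) _ _).
  - by rewrite flowB_kj //; apply/subvP => v _; rewrite mem_nullsp trmx0 mul0mx.
  - by lia.
  - by [].
elim: n k i => [|n IH] k i kin jkL ij.
  by rewrite (_ : i = j.+1) ?flowB_iS ?sub0v //; lia.
have [->|kj] := eqVneq k L.+1; first by rewrite flowB_LS sub0v.
have [->|ij'] := eqVneq i j.+1; first by rewrite flowB_iS sub0v.
have [_ <- _] : is_compl _ _ _ := cB k j i ltac:(lia) ltac:(lia).
by rewrite !subv_add bS ?IH //; lia.
Qed.

Lemma dim_a k j i : (i <= j <= k)%N -> (k <= L)%N ->
  (\dim (a k j i))%:Z = (\dim (flowA w k.+1 j i.+1))%:Z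
    - (\dim (flowA w k.+1 j i))%:Z
    - ((\dim (flowA w k j i.+1))%:Z - (\dim (flowA w k j i))%:Z).
Proof.
move=> ijk kL; have [cA _ _ _] := flow_ab.
apply: dim_compl_cap (cA k j i ijk kL) _.
by apply: cap_nested; [apply: null_Wup_sub|apply: col_Wdown_sub]; lia.
Qed.

Lemma dim_b k j i : (i <= j <= k)%N -> (k <= L)%N ->
  (\dim (b k j i))%:Z = (\dim (flowB w k.+1 j i.+1))%:Z
    - (\dim (flowB w k.+1 j i))%:Z
    - ((\dim (flowB w k j i.+1))%:Z - (\dim (flowB w k j i))%:Z).
Proof.
move=> ijk kL; have [_ cB _ _] := flow_ab.
rewrite (@dim_compl_cap _ _ _ _ _ (flowB w k.+1 j i.+1) _ (cB k j i ijk kL)).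
  by lia.
rewrite capvC /flowB ![(rowsp _ :&: _)%VS]capvC.
rewrite cap_nested //; [apply: null_Wdown_sub|apply: row_Wup_sub]; lia.
Qed.

(** Of the four corners left by telescoping, only [flowA w L.+1 j j.+1] is nonzero in general, and
    it is full. *)
Lemma sum_dim_a j : (j <= L)%N ->
  (\sum_(j <= k < L.+1) \sum_(0 <= i < j.+1) \dim (a k j i))%N = d j.
Proof.
move=> jL; apply/eqP; rewrite -eqz_nat; apply/eqP.
rewrite (@telescope2 _ _ _ (fun k i => (\dim (flowA w k j i))%:Z)) //; first last.
- by move=> k i kr ir; apply: dim_a; lia.
- by lia.
rewrite !flowA_i0 flowA_kj // flowA_iS null_Wup_full !dimv0 dimvf dim_matrix.
by rewrite !subr0 [(d j * 1)%R]muln1.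
Qed.

Lemma sum_dim_b j : (j <= L)%N ->
  (\sum_(j <= k < L.+1) \sum_(0 <= i < j.+1) \dim (b k j i))%N = d j.
Proof.
move=> jL; apply/eqP; rewrite -eqz_nat; apply/eqP.
rewrite (@telescope2 _ _ _ (fun k i => (\dim (flowB w k j i))%:Z)) //; first last.
- by move=> k i kr ir; apply: dim_b; lia.
- by lia.
rewrite !flowB_LS flowB_iS flowB_kj // !dimv0.
have := dim_nullsp (Wdown w j 0)^T; rewrite mxrank_tr mxrank0 addn0 => ->; lia.
Qed.

(** Telescoping in [i] over the single row [k = L] leaves the codimension of the null space of
    [W_{L~j}]. *)
Lemma sum_dim_aL j : (j <= L)%N ->
  (\sum_(0 <= i < j.+1) \dim (a L j i))%N = \rank (Wprod w L j).
Proof.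
move=> jL; apply/eqP; rewrite -eqz_nat; apply/eqP.
(* The fixed index [L] becomes a one-term outer sum, so that [telescope2] applies. *)
rewrite -[X in X%:Z](big_nat1 addn L (fun k => \sum_(0 <= i < j.+1) \dim (a k j i))%N).
rewrite (@telescope2 _ _ _ (fun k i => (\dim (flowA w k j i))%:Z)) //; first last.
  by move=> k i kr ir; apply: dim_a; lia.
rewrite !flowA_i0 !flowA_iS null_Wup_full !dimv0 dimvf dim_matrix.
have -> : nullsp (Wup w L j) = nullsp (Wprod w L j).
  by apply/vspaceP => v; rewrite mem_null_Wup // mem_nullsp.
by have := dim_nullsp (Wprod w L j); rewrite -[(d j * 1)%R]/(d j * 1)%N; lia.
Qed.

(** Dually, the column [i = 0] leaves the codimension of the null space of the transpose of
    [W_{j~0}]. *)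
Lemma sum_dim_b0 j : (j <= L)%N ->
  (\sum_(j <= k < L.+1) \dim (b k j 0))%N = \rank (Wprod w j 0).
Proof.
move=> jL; apply/eqP; rewrite -eqz_nat; apply/eqP.
under eq_bigr => k _ do rewrite -(big_nat1 addn 0%N (fun i => \dim (b k j i))).
rewrite (@telescope2 _ _ _ (fun k i => (\dim (flowB w k j i))%:Z)) //; first last.
- by move=> k i kr ir; apply: dim_b; lia.
- by lia.
rewrite !flowB_LS !flowB_kj // !dimv0.
have := dim_nullsp (Wdown w j 0)^T; have := dim_nullsp (Wdown w j 1)^T.
by rewrite !mxrank_tr mxrank0 /=; lia.
Qed.

(** A vector of [a l j i] killed by [W_{l~j}] lies in [flowA w l j i.+1], part of the subspace that
    [a l j i] complements. With [a_null]: the flow from [a l j i] survives up to layer [l] and dies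
    beyond. *)
Lemma a_inj l j i v : (i <= j <= l)%N -> (l <= L)%N -> v \in a l j i ->
  Wprod w l j *m v = 0 -> v = 0.
Proof.
move=> ijl lL va /eqP v0; have [cA _ _ _] := flow_ab.
have [/subvP aA _ a0] := cA l j i ijl lL; apply/eqP; rewrite -memv0 -a0 memv_cap va.
apply: (subvP (addvSr _ _)); rewrite memv_cap mem_null_Wup // v0 /=.
by move: (aA _ va); rewrite memv_cap => /andP[].
Qed.

Lemma a_null l j i m v : (i <= j <= l)%N -> (l < m <= L)%N -> v \in a l j i ->
  Wprod w m j *m v = 0.
Proof.
move=> ijl lm va; have [cA _ _ _] := flow_ab.
have [/subvP aA _ _] := cA l j i ijl ltac:(lia).
move: (aA _ va); rewrite memv_cap mem_null_Wup ?(@Wprod_split m l.+1 j); try lia.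
by move=> /andP[/eqP v0 _]; rewrite -mulmxA v0 mulmx0.
Qed.

Lemma a_flow l j m i : (i <= j <= m)%N -> (m <= l <= L)%N ->
  a l m i = (mulV (Wprod w m j) @: a l j i)%VS.
Proof.
move=> /andP[ij]; elim: m => [|m IH] jm ml.
  by rewrite (_ : j = 0%N) ?Wprod_id ?mulV1 //; lia.
have [<-|jm'] := eqVneq j m.+1.
  by rewrite Wprod_id mulV1.
have [_ _ fA _] := flow_ab; rewrite fA; try lia.
rewrite IH -?limg_comp; try lia; congr (_ @: _)%VS.
by apply/lfunP => v; rewrite comp_lfunE !mulVE mulmxA -WprodS //; lia.
Qed.

(** Dually, a killed vector lies in [flowB w k j h.+1]. With [b_null]: going backwards by
    transposes, the flow survives down to layer [h] and no further. *)
Lemma b_inj k j h v : (h <= j <= k)%N -> (k <= L)%N -> v \in b k j h ->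
  (Wprod w j h)^T *m v = 0 -> v = 0.
Proof.
move=> hjk kL vb /eqP v0; have [_ cB _ _] := flow_ab.
have [/subvP bB _ b0] := cB k j h hjk kL; apply/eqP; rewrite -memv0 -b0 memv_cap vb.
apply: (subvP (addvSl _ _)); rewrite memv_cap mem_nullsp v0 andbT.
by move: (bB _ vb); rewrite memv_cap => /andP[].
Qed.

Lemma b_null k j h m v : (h <= j <= k)%N -> (k <= L)%N -> (m < h)%N ->
  v \in b k j h -> (Wprod w j m)^T *m v = 0.
Proof.
move=> hjk kL mh vb; have [_ cB _ _] := flow_ab.
have [/subvP bB _ _] := cB k j h hjk kL.
move: (bB _ vb); rewrite memv_cap mem_nullsp => /andP[_].
case: h hjk mh vb bB => [//|h] hjk mh vb bB /= /eqP v0.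
by rewrite (@Wprod_split j h m) ?trmx_mul -?mulmxA ?v0 ?mulmx0 //; lia.
Qed.

Lemma b_flow k j m h : (h <= m <= j)%N -> (j <= k <= L)%N ->
  b k m h = (mulV (Wprod w j m)^T @: b k j h)%VS.
Proof.
move=> /andP[hm]; elim: j => [|j IH] mj jk; last have [<-|mj'] := eqVneq m j.+1.
- by rewrite (_ : m = 0%N) ?Wprod_id ?trmx1 ?mulV1 //; lia.
- by rewrite Wprod_id trmx1 mulV1.
have [_ _ _ fB] := flow_ab; rewrite IH; try lia.
rewrite [b k j h](fB k j.+1 h) -?limg_comp; try lia; congr (_ @: _)%VS.
apply/lfunP => v; rewrite comp_lfunE !mulVE mulmxA -trmx_mul -WprodS //; lia.
Qed.

End Flow.

(** * Placing matrices in the weight space, and the differential on them *)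

Section Weights.
Context (R : realType) (L : nat) (d : nat -> nat).

Lemma weight_sum (u : weight_space R L d) :
  u = \sum_(t < L) place L (layer u t.+1 : 'M[R]_(d t.+1, d t.+1.-1)).
Proof.
apply/mxrowP => t; rewrite [in RHS]/submxrow [RHS]linear_sum /=.
under eq_bigr => s _ do rewrite -/(submxrow _ _) mxrowK.
rewrite (bigD1 t) //= eqxx big1 ?addr0 => [|s st]; last first.
  by case: eqP => // -[ts]; case/eqP: st; apply/val_inj.
rewrite conform_mx_id /layer (big_pred1 t) => [|s]; last by rewrite eqSS.
by rewrite conform_mx_id vec_mxK.
Qed.

Lemma place_inj j (M : 'M[R]_(d j, d j.-1)) : (0 < j <= L)%N ->
  place L M = 0 -> M = 0.
Proof.
move=> jL M0; rewrite -(layer_place M jL) M0.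
(* Linearity with scalar -1 at zero vectors yields that [layer] sends 0 to 0. *)
have := layer_linear j (-1) (0 : weight_space R L d) 0.
by rewrite scaler0 addr0 scaleN1r addNr.
Qed.

Variable w : weight_space R L d.

Lemma dmu_place j (M : 'M[R]_(d j, d j.-1)) : (0 < j <= L)%N ->
  dmu w (place L M) = Wprod w L j *m M *m Wprod w j.-1 0.
Proof.
move=> jL; rewrite /dmu (bigD1_seq j) ?iota_uniq ?mem_index_iota //=.
rewrite layer_place // big1 ?addr0 // => m mj.
by rewrite layer_place_neq 1?eq_sym // mulmx0 mul0mx.
Qed.

(** Both terms equal [W_{L~j} H W_{j~0}] up to sign, and the signs are opposite. *)
Lemma dmu_two_matrix j (H : 'M[R]_(d j, d j)) : (0 < j < L)%N ->
  dmu w (two_matrix w H) = 0.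
Proof.
case: j H => // j H jL; rewrite /two_matrix linearD /= !dmu_place; try lia.
rewrite (@Wprod_split _ _ _ w L j.+2 j.+1) -?layerE ?(@WprodS _ _ _ w j 0) //; try lia.
by rewrite mulmxN mulNmx !mulmxA subrr.
Qed.

End Weights.

(** * Sums over tuples of indices *)

Lemma sum_pair_nat n (P Q : pred nat) (F : nat -> nat -> nat) :
  (\sum_(p : 'I_n * 'I_n | P p.1 && Q p.2) F p.1 p.2
    = \sum_(0 <= k < n | P k) \sum_(0 <= i < n | Q i) F k i)%N.
Proof.
rewrite big_mkord; under [RHS]eq_bigr => k _ do rewrite big_mkord.
by rewrite [RHS]pair_big.
Qed.

Lemma sum_nat_ge n j (F : nat -> nat) :
  (\sum_(0 <= k < n | j <= k) F k = \sum_(j <= k < n) F k)%N.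
Proof. by rewrite [RHS](big_nat_widenl _ 0). Qed.

Lemma sum_nat_le n j (F : nat -> nat) : (j < n)%N ->
  (\sum_(0 <= i < n | i <= j) F i = \sum_(0 <= i < j.+1) F i)%N.
Proof. by move=> jn; rewrite (big_nat_widen _ _ _ _ _ jn). Qed.

(** Once the layer [i] is fixed, the indices of the a factor and of the b factor vary independently,
    so the sum of products factors. *)
Lemma sum_triple (I J K : finType) (P : pred I) (A : I -> pred J) (B : I -> pred K)
    (F : I -> J -> nat) (G : I -> K -> nat) :
  (\sum_(x : I * (J * K) | [&& P x.1, A x.1 x.2.1 & B x.1 x.2.2])
      F x.1 x.2.1 * G x.1 x.2.2
   = \sum_(i | P i) (\sum_(j | A i j) F i j) * (\sum_(k | B i k) G i k))%N.
Proof.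
under [RHS]eq_bigr => i _ do rewrite big_distrlr pair_big.
by rewrite pair_big_dep.
Qed.

(** The index range of the one-matrix subspaces. Adding [j < l] and [j <= k] gives exactly that of
    the two-matrix subspaces, so both are positions on the same chains. *)
Definition flow_index L l k j i h :=
  [&& i <= j, j <= l, l <= L, h < j, j <= k.+1 & k <= L]%N.

(** * One- and two-matrix subspaces, and the exchange along chains *)

Section Exchange.
Context (R : realType) (L : nat) (d : nat -> nat) (w : weight_space R L d).
Context (a b : subspace_family R d) (flow_ab : flow_prebasis w a b).
Local Notation index := (flow_index L).
Local Notation phi := (@phi R L d a b).
Local Notation tau := (tau w a b).

Lemma dim_phi l k j i h : (0 < j <= L)%N ->
  \dim (phi l k j i h) = (\dim (a l j i) * \dim (b k j.-1 h))%N.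
Proof.
move=> jL; rewrite -dim_tensor limg_dim_eq //; apply/eqP; rewrite -subv0.
apply/subvP => M; rewrite memv_cap memv_ker lfunE memv0 => /andP[_ /eqP].
by move=> /(place_inj jL) ->.
Qed.

Lemma b_layer_inj k j h : (h < j <= k)%N -> (k <= L)%N ->
  {in b k j h, forall v, (layer w j)^T *m v = 0 -> v = 0}.
Proof.
move=> hjk kL v vb Wv0; apply: (b_inj flow_ab _ kL vb); first by lia.
case: j hjk v vb Wv0 => // j hjk v vb Wv0.
by rewrite WprodS ?trmx_mul -?mulmxA ?Wv0 ?mulmx0 //; lia.
Qed.

Lemma a_layer_inj l j i : (i <= j < l)%N -> (l <= L)%N ->
  {in a l j i, forall v, layer w j.+1 *m v = 0 -> v = 0}.
Proof.
move=> ijl lL v va Wv0; apply: (a_inj flow_ab _ lL va); first by lia.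
by rewrite (@Wprod_split _ _ _ w l j.+1) -?layerE -?mulmxA ?Wv0 ?mulmx0 //; lia.
Qed.

(** The component in position [j.+1] already determines [H], because [W_{j+1}] is injective on
    [a l j i] when [j < l]. *)
Lemma dim_tau l k j i h : index l k j i h -> (j < l)%N ->
  \dim (tau l k j i h) = (\dim (a l j i) * \dim (b k j h))%N.
Proof.
move=> idx jl; rewrite -dim_tensor limg_dim_eq //; apply/eqP; rewrite -subv0.
apply/subvP => H; rewrite memv_cap memv_ker lfunE memv0 /= => /andP[HT /eqP H0].
have WH0 : layer w j.+1 *m H = 0.
  have jL : (0 < j.+1 <= L)%N by move: idx; rewrite /flow_index; lia.
  rewrite -(layer_place (layer w j.+1 *m H) jL).
  move: H0; rewrite /two_matrix => /eqP; rewrite addr_eq0 => /eqP ->.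
  by rewrite -linearN /= layer_place_neq; last lia.
apply/eqP; apply: tensor_mull_inj HT WH0; apply: a_layer_inj;
  by move: idx; rewrite /flow_index; lia.
Qed.

Lemma dim_b_pred k j h : (h < j <= k)%N -> (k <= L)%N ->
  \dim (b k j.-1 h) = \dim (b k j h).
Proof.
move=> hjk kL; have [_ _ _ fB] := flow_ab; rewrite fB //.
by apply: dim_mulV_inj; apply: b_layer_inj.
Qed.

(** Every element of [phi] at [j] has the form [place L (H *m layer w j)]; subtracting the placement
    of [layer w j.+1 *m H] leaves [- two_matrix w H]. *)
Lemma phi_exchange l k j i h : index l k j i h -> (j < l)%N -> (j <= k)%N ->
  (phi l k j i h <= tau l k j i h + phi l k j.+1 i h)%VS.
Proof.
move=> idx jl jk; apply/subvP => _ /memv_imgP[M MT ->]; rewrite lfunE /=.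
have [_ _ fA fB] := flow_ab.
have bE : b k j.-1 h = (mulV (layer w j)^T @: b k j h)%VS.
  by apply: fB; move: idx; rewrite /flow_index; lia.
have aE : a l j.+1 i = (mulV (layer w j.+1) @: a l j i)%VS.
  by apply: (fA l j.+1 i); move: idx; rewrite /flow_index; lia.
have inj : {in b k j h, forall v, (layer w j)^T *m v = 0 -> v = 0}.
  by apply: b_layer_inj; move: idx; rewrite /flow_index; lia.
rewrite bE in MT; have [H HT ->] := tensor_mulr_surj inj MT.
have -> : place L (H *m layer w j)
    = - two_matrix w H + @place R L d j.+1 (layer w j.+1 *m H).
  by rewrite /two_matrix linearN /= opprD opprK addrAC addNr add0r.
apply: memv_add.
  by rewrite memvN -[two_matrix w H]lfunE memv_img.
rewrite -[place _ _]lfunE; apply: memv_img => /=.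
by rewrite aE; apply: tensor_mull.
Qed.

Lemma tau_null l k j i h : (0 < j < L)%N -> (tau l k j i h <= null_dmu w)%VS.
Proof.
move=> jL; apply/subvP => _ /memv_imgP[H HT ->].
by rewrite memv_ker !lfunE /= dmu_two_matrix.
Qed.

(** If [l < L], then [W_{L~j}] kills the columns of [M] by [a_null]; if [0 < h], the rows die
    against [W_{j-1~0}] by [b_null]. *)
Lemma phi_null l k j i h : index l k j i h -> (l < L)%N || (0 < h)%N ->
  (phi l k j i h <= null_dmu w)%VS.
Proof.
rewrite /flow_index => idx lh; apply/subvP => _ /memv_imgP[M /tensorP[MU MV] ->].
rewrite memv_ker !lfunE /= dmu_place; last by lia.
case/orP: lh => [lL|h0].
  suff -> : Wprod w L j *m M = 0 by rewrite mul0mx.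
  apply/matrixP => r c.
  have /colP/(_ r) := @a_null _ _ _ _ _ _ flow_ab l j i L _
    ltac:(lia) ltac:(lia) (MU (delta_mx c 0)).
  by rewrite mulmxA -colE !mxE.
suff M0 : M *m Wprod w j.-1 0 = 0 by rewrite -mulmxA M0 mulmx0.
apply: trmx_inj; rewrite trmx_mul trmx0; apply/matrixP => r c.
have /colP/(_ r) := @b_null _ _ _ _ _ _ flow_ab k j.-1 h 0 _
  ltac:(lia) ltac:(lia) h0 (MV (delta_mx c 0)).
by rewrite mulmxA -colE !mxE.
Qed.

(** Layer by layer: the matrices whose placement lies in [S] form a subspace containing all tensors
    of a's and b's, so [tensor_generate] applies. *)
Lemma phi_generate (S : {vspace weight_space R L d}) :
  (forall l k j i h, index l k j i h -> (phi l k j i h <= S)%VS) -> S = fullv.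
Proof.
move=> phiS; apply/vspaceP => u; rewrite memvf (weight_sum u).
apply: rpred_sum => t _; set M := layer u t.+1.
pose f : 'Hom('M[R]_(d t.+1, d t), weight_space R L d) := linfun (@place R L d t.+1).
suff : M \in (f @^-1: S)%VS by rewrite -memv_preim lfunE.
have tL := ltn_ord t.
rewrite (@tensor_generate _ _ _ (nat * nat) (nat * nat)
  (fun p => (p.2 <= t.+1 <= p.1)%N && (p.1 <= L)%N)
  (fun p => (p.2 <= t <= p.1)%N && (p.1 <= L)%N)
  (fun p => a p.1 t.+1 p.2) (fun p => b p.1 t p.2) _ _ (f @^-1: S)%VS).
- exact: memvf.
- move=> V aV; apply: (a_generate flow_ab tL) => k i ij kL.
  by apply: (aV (k, i)); rewrite /= ij.
- move=> V bV; apply: (b_generate flow_ab (ltnW tL)) => k i ij kL.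
  by apply: (bV (k, i)); rewrite /= ij.
- move=> p q /andP[p1 p2] /andP[q1 q2]; apply/subvP => N NT; rewrite -memv_preim.
  apply: (subvP (phiS p.1 q.1 t.+1 p.2 q.2 _)); first by rewrite /flow_index; lia.
  exact: memv_img.
Qed.

(* Q selects the chains (l, k, i, h) along which the one-matrix subspaces
   phi_j are traded for the two-matrix subspaces tau_j, except at the end of
   the chain, where tau_j is not defined. *)
Definition exchanged (Q : nat -> nat -> nat -> nat -> bool) l k j i h :=
  if [&& Q l k i h, j < l & j <= k]%N then tau l k j i h else phi l k j i h.

(** By induction on [l - j], backwards from the chain end, where nothing is exchanged:
    [phi_exchange] recovers [phi] at [j] from [tau] at [j] and [phi] at [j.+1]. *)
Lemma exchanged_generate Q (S : {vspace weight_space R L d}) :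
  (forall l k j i h, index l k j i h -> (exchanged Q l k j i h <= S)%VS) ->
  S = fullv.
Proof.
move=> exS; apply: phi_generate => l k j i h.
elim: {j}(l - j)%N {-2}j (leqnn (l - j)) => [|n IH] j ln idx.
  by have := exS _ _ _ _ _ idx; rewrite /exchanged ifF //; lia.
have := exS _ _ _ _ _ idx; rewrite /exchanged; case: ifP => // /and3P[_ jl jk] tauS.
apply: subv_trans (phi_exchange idx jl jk) _; rewrite subv_add tauS /=.
by apply: IH; move: idx; rewrite /flow_index; lia.
Qed.

Lemma dim_exchanged Q l k j i h : index l k j i h ->
  \dim (exchanged Q l k j i h) = (\dim (a l j i) * \dim (b k j.-1 h))%N.
Proof.
move=> idx; rewrite /exchanged; case: ifP => [/and3P[_ jl jk]|_].
  by rewrite dim_tau // dim_b_pred //; move: idx; rewrite /flow_index; lia.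
by rewrite dim_phi //; move: idx; rewrite /flow_index; lia.
Qed.

End Exchange.

(** * The exchanged family without the special chain ends is a prebasis of the kernel *)

Section Kernel.
Context (R : realType) (L : nat) (d : nat -> nat) (w : weight_space R L d).
Context (a b : subspace_family R d) (flow_ab : flow_prebasis w a b).
Local Notation I := 'I_L.+1.
Local Notation T := (I * ((I * I) * (I * I)))%type.

(* An index x stands for (j, ((l, i), (k, h))). *)
Definition at_index (S : Type) (F : nat -> nat -> nat -> nat -> nat -> S) (x : T) : S :=
  F x.2.1.1 x.2.2.1 x.1 x.2.1.2 x.2.2.2.

Definition mk_index (l k j i h : nat) : T :=
  (inord j, ((inord l, inord i), (inord k, inord h))).

Lemma at_mk_index S (F : nat -> nat -> nat -> nat -> nat -> S) l k j i h :
  flow_index L l k j i h -> at_index F (mk_index l k j i h) = F l k j i h.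
Proof. by rewrite /flow_index /at_index => idx; rewrite !inordK //; lia. Qed.

(** By [phi_null], only on these chains can [dmu w] be nonzero on a one-matrix subspace. *)
Definition special (l k j i h : nat) := (l == L) && (h == 0%N).
(** Within the index range this means [j = minn l k.+1]. *)
Definition chain_end (l k j i h : nat) := ~~ ((j < l) && (j <= k))%N.
Definition kernel_index (x : T) : bool :=
  at_index (flow_index L) x && ~~ (at_index special x && at_index chain_end x).
Local Notation valid := (at_index (flow_index L)).

Lemma sum_valid (G : nat -> nat -> nat -> nat) (H : nat -> nat -> nat -> nat) :
  (\sum_(x : T | valid x) G x.1 x.2.1.1 x.2.1.2 * H x.1.-1 x.2.2.1 x.2.2.2
   = \sum_(1 <= j < L.+1)
       (\sum_(j <= l < L.+1) \sum_(0 <= i < j.+1) G j l i) *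
       (\sum_(j.-1 <= k < L.+1) \sum_(0 <= h < j.-1.+1) H j.-1 k h))%N.
Proof.
rewrite -sum_nat_ge big_mkord.
(* The range splits into conditions on [j], on [(l, i)] and on [(k, h)]; the bounds by [L] are
   carried by the ordinals. *)
transitivity (\sum_(x : T | [&& 0 < x.1, (x.1 <= x.2.1.1) && (x.2.1.2 <= x.1)
    & (x.1.-1 <= x.2.2.1) && (x.2.2.2 <= x.1.-1)])
  G x.1 x.2.1.1 x.2.1.2 * H x.1.-1 x.2.2.1 x.2.2.2)%N.
  apply: eq_bigl => -[j [[l i] [k h]]]; rewrite /at_index /flow_index /=.
  by have := ltn_ord l; have := ltn_ord k; lia.
rewrite (@sum_triple I (I * I)%type (I * I)%type (fun j => 0 < j)%N
  (fun j p => (j <= p.1) && (p.2 <= j))%N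
  (fun j p => (j.-1 <= p.1) && (p.2 <= j.-1))%N
  (fun j p => G j p.1 p.2) (fun j p => H j.-1 p.1 p.2)).
apply: eq_bigr => j j0; have jL := ltn_ord j; congr muln.
- rewrite (sum_pair_nat _ (fun k => j <= k)%N (fun i => i <= j)%N (G j)) sum_nat_ge.
  by apply: eq_bigr => k _; apply: sum_nat_le.
- rewrite (sum_pair_nat _ (fun k => j.-1 <= k)%N (fun i => i <= j.-1)%N (H j.-1)).
  by rewrite sum_nat_ge; apply: eq_bigr => k _; apply: sum_nat_le; lia.
Qed.

Lemma sum_special (G : nat -> nat -> nat -> nat) (H : nat -> nat -> nat -> nat) :
  (\sum_(x : T | valid x && at_index special x)
      G x.1 x.2.1.1 x.2.1.2 * H x.1.-1 x.2.2.1 x.2.2.2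
   = \sum_(1 <= j < L.+1)
       (\sum_(0 <= i < j.+1) G j L i) * (\sum_(j.-1 <= k < L.+1) H j.-1 k 0%N))%N.
Proof.
rewrite -sum_nat_ge big_mkord.
transitivity (\sum_(x : T | [&& 0 < x.1, (x.2.1.1 == L :> nat) && (x.2.1.2 <= x.1)
    & (x.1.-1 <= x.2.2.1) && (x.2.2.2 == 0 :> nat)])
  G x.1 x.2.1.1 x.2.1.2 * H x.1.-1 x.2.2.1 x.2.2.2)%N.
  apply: eq_bigl => -[j [[l i] [k h]]]; rewrite /at_index /flow_index /special /=.
  by have := ltn_ord l; have := ltn_ord k; have := ltn_ord j; lia.
rewrite (@sum_triple I (I * I)%type (I * I)%type (fun j => 0 < j)%N
  (fun j p => (p.1 == L :> nat) && (p.2 <= j))%N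
  (fun j p => (j.-1 <= p.1) && (p.2 == 0 :> nat))%N
  (fun j p => G j p.1 p.2) (fun j p => H j.-1 p.1 p.2)).
apply: eq_bigr => j j0; have jL := ltn_ord j; congr muln.
- rewrite (sum_pair_nat _ (fun k => k == L) (fun i => i <= j)%N (G j)).
  by rewrite big_nat1_eq /= ltnSn; apply: sum_nat_le.
- rewrite (sum_pair_nat _ (fun k => j.-1 <= k)%N (fun i => i == 0%N) (H j.-1)).
  by rewrite sum_nat_ge; apply: eq_bigr => k _; rewrite big_nat1_eq.
Qed.

(** Here [H] is taken at layer [j], not [j.-1], to match the second sum of the dimension formula;
    [l = L] and [j < l] force [j < L]. *)
Lemma sum_special_inner (G : nat -> nat -> nat -> nat) (H : nat -> nat -> nat -> nat) :
  (\sum_(x : T | [&& valid x, at_index special x & ~~ at_index chain_end x])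
      G x.1 x.2.1.1 x.2.1.2 * H x.1 x.2.2.1 x.2.2.2
   = \sum_(1 <= j < L)
       (\sum_(0 <= i < j.+1) G j L i) * (\sum_(j <= k < L.+1) H j k 0%N))%N.
Proof.
rewrite (big_nat_widen _ _ L.+1) // (big_nat_widenl _ 0) // big_mkord.
transitivity (\sum_(x : T | [&& (x.1 < L) && (0 < x.1),
    (x.2.1.1 == L :> nat) && (x.2.1.2 <= x.1)
    & (x.1 <= x.2.2.1) && (x.2.2.2 == 0 :> nat)])
  G x.1 x.2.1.1 x.2.1.2 * H x.1 x.2.2.1 x.2.2.2)%N.
  apply: eq_bigl => -[j [[l i] [k h]]].
  rewrite /at_index /flow_index /special /chain_end /=.
  by have := ltn_ord l; have := ltn_ord k; have := ltn_ord j; lia.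
rewrite (@sum_triple I (I * I)%type (I * I)%type (fun j => (j < L) && (0 < j))%N
  (fun j p => (p.1 == L :> nat) && (p.2 <= j))%N
  (fun j p => (j <= p.1) && (p.2 == 0 :> nat))%N
  (fun j p => G j p.1 p.2) (fun j p => H j p.1 p.2)).
apply: eq_bigr => j j0; have jL := ltn_ord j; congr muln.
- rewrite (sum_pair_nat _ (fun k => k == L) (fun i => i <= j)%N (G j)).
  by rewrite big_nat1_eq /= ltnSn; apply: sum_nat_le.
- rewrite (sum_pair_nat _ (fun k => j <= k)%N (fun i => i == 0%N) (H j)).
  by rewrite sum_nat_ge; apply: eq_bigr => k _; rewrite big_nat1_eq.
Qed.

(** These tensors span all matrices of size [d L] by [d 0], and their dimensions add up to
    [d L * d 0], since [W_{L~L}] and [W_{0~0}] are identities. *)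
Lemma directv_end_tensor : directv (\sum_(p : I * I) tensor (a L L p.1) (b p.2 0%N 0%N)).
Proof.
apply: directv_dim_full.
  apply: (@tensor_generate _ _ _ I I xpredT xpredT
    (fun i => a L L i) (fun k => b k 0%N 0%N)).
  - move=> S aS; apply: (a_generate flow_ab (leqnn L)) => k i ij kL.
    have -> : k = L by lia.
    have iL : (i < L.+1)%N by lia.
    exact: (aS (Ordinal iL)).
  - move=> S bS; apply: (b_generate flow_ab (leq0n L)) => k i ij kL.
    have -> : i = 0%N by lia.
    have kL' : (k < L.+1)%N by lia.
    exact: (bS (Ordinal kL')).
  - by move=> i k _ _; apply: (sumv_sup (i, k)); rewrite ?subvv.
under eq_bigr do rewrite dim_tensor.
rewrite -(pair_big xpredT xpredT (fun i k : I => \dim (a L L i) * \dim (b k 0%N 0%N)))%N /=.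
rewrite -big_distrlr /= -(big_mkord xpredT (fun i => \dim (a L L i))).
rewrite -(big_mkord xpredT (fun k => \dim (b k 0%N 0%N))).
by rewrite (sum_dim_aL flow_ab) // (sum_dim_b0 flow_ab) // !Wprod_id !mxrank1 dim_matrix.
Qed.

Hypothesis L_gt0 : (0 < L)%N.
Variable Q : nat -> nat -> nat -> nat -> bool.
Hypothesis Q_special : forall k i, Q L k i 0.
Local Notation Y := (at_index (exchanged w a b Q)).

Lemma sum_exchanged : (\sum_(x | valid x) Y x)%VS = fullv.
Proof.
apply: (exchanged_generate flow_ab (Q := Q)) => l k j i h idx.
by apply: (sumv_sup (mk_index l k j i h)); rewrite at_mk_index.
Qed.

Lemma dim_at_exchanged x : valid x ->
  \dim (Y x) = (\dim (a x.2.1.1 x.1 x.2.1.2) * \dim (b x.2.2.1 x.1.-1 x.2.2.2))%N.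
Proof. exact: dim_exchanged. Qed.

(** The family spans, and at each layer its dimensions add up to [d j * d j.-1], so the total is the
    dimension of the weight space. *)
Lemma directv_exchanged : directv (\sum_(x | valid x) Y x).
Proof.
apply: directv_dim_full; first exact: sum_exchanged.
rewrite (eq_bigr _ dim_at_exchanged).
rewrite (sum_valid (fun j l i => \dim (a l j i)) (fun j k h => \dim (b k j h))).
rewrite dim_matrix [RHS]mul1n /dtheta big_add1 -(big_mkord xpredT (fun t => d t.+1 * d t)%N).
by apply: eq_big_nat => t tL; rewrite (sum_dim_a flow_ab) // (sum_dim_b flow_ab) // ltnW.
Qed.

(** The [tau] are always killed. A surviving [phi] has [l < L] or [0 < h]: on a special chain,
    [Q_special] has exchanged every position but the omitted end. *)
Lemma kernel_exchanged x : kernel_index x -> (Y x <= null_dmu w)%VS.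
Proof.
case: x => j [[l i] [k h]]; rewrite /kernel_index /at_index /= => /andP[idx nse].
rewrite /exchanged; case: ifP => [/and3P[_ jl jk]|nQ].
  by apply: tau_null; move: idx; rewrite /flow_index; lia.
apply: (phi_null flow_ab idx); apply/negPn/negP; rewrite negb_or => /andP[lL h0].
move/negP: nse; apply; rewrite /special /chain_end.
have eL : l = L :> nat by have := ltn_ord l; lia.
have eh : h = 0%N :> nat by lia.
by move: nQ; rewrite eL eh Q_special !eqxx /= => ->.
Qed.

(** The image is [W_{L~j} M W_{j-1~0}]. The flow relations carry its factors into [a L L i] and
    [b k 0 0], and [a_inj], [b_inj] make both multiplications injective there. *)
Lemma phi_end_inj i k u : flow_index L L k (minn L k.+1) i 0 ->
  u \in phi L a b L k (minn L k.+1) i 0 ->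
  dmu w u \in tensor (a L L i) (b k 0%N 0%N) /\ (dmu w u = 0 -> u = 0).
Proof.
set j := minn L k.+1 => idx /memv_imgP[M MT ->].
have jL : (0 < j <= L)%N by rewrite /j; lia.
have kL : (k <= L)%N by move: idx; rewrite /flow_index; lia.
have jk : (j.-1 <= k)%N by rewrite /j; lia.
have ij : (i <= j)%N by move: idx; rewrite /flow_index; lia.
rewrite lfunE /= dmu_place //; split.
  rewrite (a_flow flow_ab (j := j)) ?ij; try lia.
  rewrite (b_flow flow_ab (j := j.-1)); try lia.
  by apply: tensor_mulr; apply: tensor_mull.
move=> /(tensor_mulr_inj _ (tensor_mull _ MT)) WM0.
suff -> : M = 0 by rewrite linear0.
apply: tensor_mull_inj MT _ => [v va|]; first by apply: (a_inj flow_ab) va; lia.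
by apply: WM0 => v vb; apply: (b_inj flow_ab) vb; lia.
Qed.

Lemma null_dmu_exchanged : null_dmu w = (\sum_(x | kernel_index x) Y x)%VS.
Proof.
apply/eqP; rewrite eqEsubv; apply/andP; split; last first.
  by apply/subv_sumP => x; apply: kernel_exchanged.
(* A special chain is determined by [(i, k)]; [E] takes the one-matrix subspace at its end, the only
   valid position missing from [kernel_index]. *)
pose P (p : I * I) := flow_index L L p.2 (minn L p.2.+1) p.1 0.
pose E (p : I * I) := phi L a b L p.2 (minn L p.2.+1) p.1 0.
have fullE : (\sum_(x | kernel_index x) Y x + \sum_(p | P p) E p)%VS = fullv.
  apply/eqP; rewrite eqEsubv subvf -sum_exchanged; apply/subv_sumP => x vx.
  have [Kx|] := boolP (kernel_index x).
    by apply: subv_trans (addvSl _ _); apply: (sumv_sup x); rewrite ?subvv.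
  rewrite /kernel_index vx /= negbK => /andP[].
  case: x vx => j [[l i] [k h]]; rewrite /at_index /= => idx.
  rewrite /special /chain_end => /andP[/eqP lL /eqP h0] ce.
  have jE : j = minn L k.+1 :> nat by move: idx ce; rewrite /flow_index; lia.
  apply: subv_trans (addvSr _ _); apply: (sumv_sup (i, k)).
    by move: idx; rewrite /P /= lL h0 jE.
  by rewrite /exchanged (negbTE ce) andbF /E /= -jE lL h0 subvv.
apply/subvP => u; rewrite memv_ker lfunE /= => /eqP u0.
have : u \in (\sum_(x | kernel_index x) Y x + \sum_(p | P p) E p)%VS.
  by rewrite fullE memvf.
move=> /memv_addP[y yK [v vE uE]]; suff v0 : v = 0 by rewrite uE v0 addr0.
have {u uE u0} dv0 : dmu w v = 0.
  have : y \in null_dmu w.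
    apply: (subvP _ _ yK); apply/subv_sumP => x; exact: kernel_exchanged.
  by rewrite memv_ker lfunE /= => /eqP y0; rewrite -u0 uE linearD /= y0 add0r.
have [vs vsE vE'] := memv_sumP vE.
have dvs p : P p -> dmu w (vs p) = 0.
  (* The images of the components of [v] lie in independent subspaces and add up to zero, so each of
     them vanishes. *)
  have /directv_sum_independent ind :
      directv (\sum_(q | P q) tensor (a L L q.1) (b q.2 0%N 0%N)).
    exact: directv_sub directv_end_tensor.
  apply: (ind (fun q => dmu w (vs q))).
  - by move=> q Pq; have [] := phi_end_inj Pq (vsE q Pq).
  - by rewrite -linear_sum -vE'.
rewrite vE' big1 // => p Pp; have [_] := phi_end_inj Pp (vsE p Pp).
by apply; apply: dvs.
Qed.

Lemma directv_kernel : directv (\sum_(x | kernel_index x) Y x).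
Proof. by apply: directv_sub directv_exchanged => x /andP[]. Qed.

Definition kernel_family : set {vspace weight_space R L d} :=
  [set s | exists x, [/\ kernel_index x, Y x <> 0%VS & s = Y x]]%classic.

Lemma prebasis_exchanged : prebasis kernel_family (null_dmu w).
Proof. by rewrite null_dmu_exchanged; apply: prebasis_directv directv_kernel. Qed.

(** The kernel family is the whole family minus the special positions plus the inner special ones,
    which give the three terms of the formula. The additive form avoids truncated subtraction. *)
Lemma dim_null_dmu :
  (\dim (null_dmu w) + \sum_(1 <= j < L.+1) \rank (Wprod w L j) * \rank (Wprod w j.-1 0)
   = dtheta L d + \sum_(1 <= j < L) \rank (Wprod w L j) * \rank (Wprod w j 0))%N.
Proof.
have full : (\sum_(x | valid x) \dim (Y x))%N = dtheta L d.
  have := directvP directv_exchanged; rewrite /= sum_exchanged dimvf dim_matrix.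
  by rewrite [X in X = _ -> _]mul1n.
have -> : \dim (null_dmu w) = (\sum_(x | kernel_index x) \dim (Y x))%N.
  by rewrite null_dmu_exchanged; apply: (directvP directv_kernel).
have spec : (\sum_(x | valid x && at_index special x) \dim (Y x))%N
    = (\sum_(1 <= j < L.+1) \rank (Wprod w L j) * \rank (Wprod w j.-1 0))%N.
  rewrite (eq_bigr _ (fun x vx => dim_at_exchanged (andP vx).1)).
  rewrite (sum_special (fun j l i => \dim (a l j i)) (fun j k h => \dim (b k j h))).
  by apply: eq_big_nat => j jL;
    rewrite (sum_dim_aL flow_ab) ?(sum_dim_b0 flow_ab) //; lia.
have inner : (\sum_(x | [&& valid x, at_index special x & ~~ at_index chain_end x])
      \dim (Y x))%N
    = (\sum_(1 <= j < L) \rank (Wprod w L j) * \rank (Wprod w j 0))%N.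
  (* At an inner position [j <= k], so the b factor has the same dimension at [j.-1] and at [j]. *)
  transitivity (\sum_(x : T | [&& valid x, at_index special x & ~~ at_index chain_end x])
      \dim (a x.2.1.1 x.1 x.2.1.2) * \dim (b x.2.2.1 x.1 x.2.2.2))%N.
    apply: eq_bigr => -[j [[l i] [k h]]] /and3P[idx _].
    rewrite (dim_at_exchanged idx) /at_index /chain_end negbK /= => /andP[_ jk].
    by rewrite (dim_b_pred flow_ab) //; move: idx; rewrite /at_index /flow_index /=; lia.
  rewrite (sum_special_inner (fun j l i => \dim (a l j i)) (fun j k h => \dim (b k j h))).
  by apply: eq_big_nat => j jL;
    rewrite (sum_dim_aL flow_ab) ?(sum_dim_b0 flow_ab) //; lia.
have split_valid := bigID (at_index special) valid (fun x => \dim (Y x)).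
have split_kernel : (\sum_(x | kernel_index x) \dim (Y x)
    = \sum_(x | [&& valid x, at_index special x & ~~ at_index chain_end x]) \dim (Y x)
      + \sum_(x | valid x && ~~ at_index special x) \dim (Y x))%N.
  rewrite (bigID (at_index special)) /=; congr addn; apply: eq_bigl => x;
    by rewrite /kernel_index; case: (at_index special x); rewrite ?andbF ?andbT.
rewrite -[X in _ = (X + _)%N]full split_valid split_kernel -spec -inner.
by rewrite /= addnC addnA addnAC.
Qed.

End Kernel.

(** * Identifying the sets of the theorem with exchanged families *)

Section ThetaSets.
Context (R : realType) (L : nat) (d : nat -> nat) (w : weight_space R L d).
Context (a b : subspace_family R d).
Local Notation Y Q := (exchanged w a b Q).

Lemma kernel_familyP Q s : kernel_family w a b Q s <->
  exists l k j i h,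
    [/\ flow_index L l k j i h, ~~ (special L l k j i h && chain_end l k j i h),
        Y Q l k j i h <> 0%VS & s = Y Q l k j i h].
Proof.
split=> [[x [/andP[idx nse] Y0 ->]]|[l [k [j [i [h [idx nse Y0 ->]]]]]]].
  by exists x.2.1.1, x.2.2.1, x.1, x.2.1.2, x.2.2.2.
exists (mk_index L l k j i h); rewrite /kernel_index !at_mk_index //.
by split=> //; rewrite idx.
Qed.

(** The [0] fills the position [j], on which [special] does not depend. *)
Definition free_chain l k i h := special L l k 0 i h.
Definition fiber_chain l k i h := special L l k 0 i h || ((k < l) && (h < i))%N.

Lemma ThetaFreeE : ThetaFree w a b = kernel_family w a b free_chain.
Proof.
apply/seteqP; split=> s /=.
  move=> sT; apply/kernel_familyP; case: sT => -[l [k [j [i [h]]]]].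
    move=> [[c1 c2] [c3 c4] c5 s0 sE]; exists l, k, j, i, h.
    have -> : Y free_chain l k j i h = phi L a b l k j i h.
      by rewrite /exchanged ifF // /free_chain /special; lia.
    by split=> //; rewrite /flow_index /special /chain_end; lia.
  move=> [[c1 c2] [c3 c4] [c5 c6] s0 sE]; exists l, k, j, i, h.
  have -> : Y free_chain l k j i h = tau w a b l k j i h.
    by rewrite /exchanged ifT // /free_chain /special; lia.
  by split=> //; rewrite /flow_index /special /chain_end; lia.
move=> /kernel_familyP[l [k [j [i [h []]]]]].
rewrite /flow_index /special /chain_end /exchanged /free_chain /special => idx nse.
case: ifP => c s0 sE; [right|left]; exists l, k, j, i, h; split=> //; lia.
Qed.

(** The one-matrix subspaces added to [ThetaStrat] have [j = k.+1] and [k < l]: they are the ends of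
    the exchanged chains that are not special, where no [tau] is available. *)
Lemma ThetaFiberE : ThetaFiber w a b = kernel_family w a b fiber_chain.
Proof.
apply/seteqP; split=> s /=.
  move=> sT; apply/kernel_familyP; case: sT => [[]|] [l [k [j [i [h]]]]].
  - move=> [[c1 c2] [c3 c4] c5 s0 sE]; exists l, k, j, i, h.
    have -> : Y fiber_chain l k j i h = phi L a b l k j i h.
      by rewrite /exchanged ifF // /fiber_chain /special; lia.
    by split=> //; rewrite /flow_index /special /chain_end; lia.
  - move=> [[c1 c2] [c3 c4] c5 s0 sE]; exists l, k, j, i, h.
    have -> : Y fiber_chain l k j i h = tau w a b l k j i h.
      by rewrite /exchanged ifT // /fiber_chain /special; lia.
    by split=> //; rewrite /flow_index /special /chain_end; lia.
  - move=> [[c1 c2] [c3 c4] [c5 c6 c7 c8] s0 sE]; exists l, k, j, i, h.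
    have -> : Y fiber_chain l k j i h = phi L a b l k j i h.
      by rewrite /exchanged ifF // /fiber_chain /special; lia.
    by split=> //; rewrite /flow_index /special /chain_end; lia.
move=> /kernel_familyP[l [k [j [i [h []]]]]].
rewrite /flow_index /special /chain_end /exchanged /fiber_chain /special => idx nse.
case: ifP => c s0 sE; first by left; right; exists l, k, j, i, h; split=> //; lia.
(* On a chain with [k < l] and [h < i], an unexchanged position must be the end [j = k.+1]. *)
have [nf|f] := boolP ((k < l) && (h < i))%N.
  by right; exists l, k, j, i, h; split=> //; [lia|lia|split; lia].
by left; left; exists l, k, j, i, h; split=> //; lia.
Qed.

End ThetaSets.

Theorem theorem40 (R : realType) (L : nat) (d : nat -> nat)
    (L_ge1 : (1 <= L)%N) (d_ge1 : forall j : nat, (j <= L)%N -> (1 <= d j)%N)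
    (theta : weight_space R L d) (a b : subspace_family R d)
    (flow_ab : flow_prebasis theta a b) :
  [/\ prebasis (ThetaFree theta a b) (null_dmu theta),
      prebasis (ThetaFiber theta a b) (null_dmu theta),
      null_dmu theta = spanset (ThetaFree theta a b)
        /\ spanset (ThetaFree theta a b) = spanset (ThetaFiber theta a b)
    & (\dim (null_dmu theta))%:Z =
        (dtheta L d)%:Z
        - (\sum_(1 <= j < L.+1)
             \rank (Wprod theta L j) * \rank (Wprod theta j.-1 0))%N%:Z
        + (\sum_(1 <= j < L)
             \rank (Wprod theta L j) * \rank (Wprod theta j 0))%N%:Z].
Proof.
have free : prebasis (ThetaFree theta a b) (null_dmu theta).
  rewrite ThetaFreeE; apply: prebasis_exchanged => // k i.
  by rewrite /free_chain /special !eqxx.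
have fiber : prebasis (ThetaFiber theta a b) (null_dmu theta).
  rewrite ThetaFiberE; apply: prebasis_exchanged => // k i.
  by rewrite /fiber_chain /special !eqxx.
have dimE := dim_null_dmu flow_ab L_ge1 (Q := free_chain L).
split=> //; first by case: free fiber => _ _ -> [_ _ ->].
rewrite -addrAC -PoszD -dimE ?PoszD ?addrK // => k i.
by rewrite /free_chain /special !eqxx.
Qed.
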